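(* Suppose $X$ is a compact Hausdorff space. The following are equivalent: (1) The conjugation map $f\mapsto \bar f$ is a local multiplication on $C(X)$. (2) $X$ is an F-space. (3) The set of $\mathbb{R}$-linear local multiplications on $C(X)$ consists of all maps $T:C(X)\to C(X)$ of the form $$T(f)=T(1)\operatorname{Re}(f)+T(i)\operatorname{Im}(f)\quad\text{for every } f\in C(X).$$
   Context: $C(X)$ denotes the algebra of complex-valued continuous functions on $X$, and $C_R(X)$ the real-valued ones. A map $T$ on $C(X)$ is a local multiplication if for each $f\in C(X)$ there is $a_f\in C(X)$ with $T(f)=a_f f$. A cozero-set in $X$ is a set of the form $\{x\in X: f(x)\neq 0\}$ with $f\in C(X)$. A completely regular Hausdorff space $X$ is an F-space if for every cozero-set $A$ in $X$, every bounded function in $C_R(A)$ extends to a bounded function in $C_R(X)$. *)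

(* Defs.v *)
From HB Require Import structures.
From mathcomp Require Import all_boot all_order all_algebra.
From mathcomp Require Import all_classical all_reals all_analysis.
From mathcomp Require Export complex.

Set Implicit Arguments.
Unset Strict Implicit.
Unset Printing Implicit Defensive.

Import Order.TTheory GRing.Theory Num.Theory.
Import numFieldNormedType.Exports.

Local Open Scope classical_set_scope.
Local Open Scope ring_scope.

(* The copy [R[i]^o] of the complex numbers is the one on which the library
   puts the topology of the modulus. *)
Definition cfun (R : realType) (X : topologicalType) : Type :=
  continuousType X R[i]^o.

HB.instance Definition _ (R : realType) (X : topologicalType) :=
  Choice.on (cfun R X).

Definition cfun_apply (R : realType) (X : topologicalType) (f : cfun R X)
  : X -> R[i] := f.
Coercion cfun_apply : cfun >-> Funclass.

Section algebra.
Context {R : realType} {X : topologicalType}.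
Implicit Types (f g h : cfun R X) (a b : R[i]).

Definition cfun_of (f : X -> R[i]^o) (cf : continuous f) : cfun R X :=
  HB.pack_for (continuousType X R[i]^o) f (isContinuous.Build X R[i]^o f cf).

Lemma cfun_ext f g : (forall x, f x = g x) -> f = g.
Proof. by move=> fg; apply/continuousEP. Qed.

Lemma cfun_continuous f : continuous (f : X -> R[i]^o).
Proof. exact: (@cts_fun _ _ (f : continuousType X R[i]^o)). Qed.

Fact cfun_cst_subproof a : continuous ((fun=> a) : X -> R[i]^o).
Proof. exact: cst_continuous. Qed.

Fact cfun_opp_subproof f : continuous ((fun x => - f x) : X -> R[i]^o).
Proof.
by move=> x; apply: (@cvgN _ R[i]^o); exact: cfun_continuous.
Qed.

Fact cfun_add_subproof f g :
  continuous ((fun x => f x + g x) : X -> R[i]^o).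
Proof.
by move=> x; apply: (@cvgD _ R[i]^o); exact: cfun_continuous.
Qed.

Fact cfun_mul_subproof f g :
  continuous ((fun x => f x * g x) : X -> R[i]^o).
Proof.
by move=> x; apply: (@cvgM R[i]); exact: cfun_continuous.
Qed.

Fact cfun_lip_subproof (u : R[i] -> R[i]) f :
  (forall z w, `|u z - u w| <= `|z - w|) ->
  continuous ((fun x => u (f x)) : X -> R[i]^o).
Proof.
move=> lipu x; apply/(@cvgrPdist_lt _ R[i]^o) => e e0.
have /(@cvgrPdist_lt _ R[i]^o) /(_ e e0) := @cfun_continuous f x.
by apply: filterS => y; exact: le_lt_trans (lipu _ _).
Qed.

Fact conjc_lip (z w : R[i]) : `|conjc z - conjc w| <= `|z - w|.
Proof.
by rewrite -rmorphB; case: (z - w) => a b; rewrite !normc_def /= sqrrN.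
Qed.

Fact Re_lip (z w : R[i]) : `|(complex.Re z)%:C%C - (complex.Re w)%:C%C| <= `|z - w|.
Proof.
rewrite -rmorphB /= -raddfB; apply: le_trans (normc_ge_Re _).
by rewrite normc_def /= expr0n addr0 sqrtr_sqr.
Qed.

Fact Im_lip (z w : R[i]) : `|(complex.Im z)%:C%C - (complex.Im w)%:C%C| <= `|z - w|.
Proof.
rewrite -rmorphB /= -raddfB; case: (z - w) => a b.
by rewrite !normc_def /= expr0n addr0 lecR ler_sqrt ?lerDr ?addr_ge0 ?sqr_ge0.
Qed.

Definition cfun_cst a : cfun R X := cfun_of (@cfun_cst_subproof a).
Definition cfun_opp f : cfun R X := cfun_of (@cfun_opp_subproof f).
Definition cfun_add f g : cfun R X := cfun_of (@cfun_add_subproof f g).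
Definition cfun_mul f g : cfun R X := cfun_of (@cfun_mul_subproof f g).

Definition cfun_conj f : cfun R X := cfun_of (@cfun_lip_subproof _ f conjc_lip).
Definition cfun_Re f : cfun R X := cfun_of (@cfun_lip_subproof _ f Re_lip).
Definition cfun_Im f : cfun R X := cfun_of (@cfun_lip_subproof _ f Im_lip).

Fact cfun_addA : associative cfun_add.
Proof. by move=> f g h; apply/cfun_ext => x; exact: addrA. Qed.
Fact cfun_addC : commutative cfun_add.
Proof. by move=> f g; apply/cfun_ext => x; exact: addrC. Qed.
Fact cfun_add0 : left_id (cfun_cst 0) cfun_add.
Proof. by move=> f; apply/cfun_ext => x; exact: add0r. Qed.
Fact cfun_addN : left_inverse (cfun_cst 0) cfun_opp cfun_add.
Proof. by move=> f; apply/cfun_ext => x; exact: addNr. Qed.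

HB.instance Definition _ := GRing.isZmodule.Build (cfun R X)
  cfun_addA cfun_addC cfun_add0 cfun_addN.

Fact cfun_mulA : associative cfun_mul.
Proof. by move=> f g h; apply/cfun_ext => x; exact: mulrA. Qed.
Fact cfun_mulC : commutative cfun_mul.
Proof. by move=> f g; apply/cfun_ext => x; exact: mulrC. Qed.
Fact cfun_mul1 : left_id (cfun_cst 1) cfun_mul.
Proof. by move=> f; apply/cfun_ext => x; exact: mul1r. Qed.
Fact cfun_mulDl : left_distributive cfun_mul +%R.
Proof. by move=> f g h; apply/cfun_ext => x; exact: mulrDl. Qed.

(* Only a possibly trivial ring: [X] may be empty. *)
HB.instance Definition _ := GRing.Zmodule_isComPzRing.Build (cfun R X)
  cfun_mulA cfun_mulC cfun_mul1 cfun_mulDl.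

Definition cfun_scale a f : cfun R X := cfun_mul (cfun_cst a) f.

Fact cfun_scaleA a b f :
  cfun_scale a (cfun_scale b f) = cfun_scale (a * b) f.
Proof. by apply/cfun_ext => x; exact: mulrA. Qed.
Fact cfun_scale1 : left_id 1 cfun_scale.
Proof. by move=> f; apply/cfun_ext => x; exact: mul1r. Qed.
Fact cfun_scaleDr : right_distributive cfun_scale +%R.
Proof. by move=> a f g; apply/cfun_ext => x; exact: mulrDr. Qed.
Fact cfun_scaleDl f : {morph cfun_scale^~ f : a b / a + b}.
Proof. by move=> a b; apply/cfun_ext => x; exact: mulrDl. Qed.

HB.instance Definition _ := GRing.Zmodule_isLmodule.Build R[i] (cfun R X)
  cfun_scaleA cfun_scale1 cfun_scaleDr cfun_scaleDl.

Lemma cfunD f g x : (f + g) x = f x + g x. Proof. by []. Qed.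
Lemma cfunM f g x : (f * g) x = f x * g x. Proof. by []. Qed.
Lemma cfun1 x : (1 : cfun R X) x = 1. Proof. by []. Qed.
Lemma cfunZ a f x : (a *: f) x = a * f x. Proof. by []. Qed.
Lemma cfun_conjE f x : cfun_conj f x = conjc (f x). Proof. by []. Qed.
Lemma cfun_ReE f x : cfun_Re f x = (complex.Re (f x))%:C%C. Proof. by []. Qed.
Lemma cfun_ImE f x : cfun_Im f x = (complex.Im (f x))%:C%C. Proof. by []. Qed.

Definition local_multiplication (T : cfun R X -> cfun R X) : Prop :=
  forall f, exists a : cfun R X, T f = a * f.

Definition real_linear (T : cfun R X -> cfun R X) : Prop :=
  forall (r : R) f g, T (r%:C%C *: f + g) = r%:C%C *: T f + T g.

End algebra.

Definition cozero_set (R : realType) (X : topologicalType) (A : set X) : Prop :=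
  exists f : cfun R X, A = [set x | f x != 0].

(* A function in C_R(A) is given by an [f : X -> R] whose values off [A] are
   irrelevant: [{within A, continuous f}] is continuity of the restriction of
   [f] to [A] for the subspace topology. *)
Definition F_space (R : realType) (X : topologicalType) : Prop :=
  [/\ completely_regular_space X, hausdorff_space X &
      forall A : set X, cozero_set R A ->
      forall f : X -> R, {within A, continuous f} ->
        [bounded f x | x in A] ->
      exists g : X -> R, [/\ continuous g, [bounded g x | x in [set: X]] &
                             forall x, A x -> g x = f x]].

(* Main.v *)
Require Import Defs.
From HB Require Import structures.
From mathcomp Require Import all_boot all_order all_algebra.
From mathcomp Require Import all_classical all_reals all_analysis.
From mathcomp Require Import ring lra.
Import Order.TTheory GRing.Theory Num.Theory.
Import numFieldNormedType.Exports.
Local Open Scope classical_set_scope.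
Local Open Scope ring_scope.

(** A multiplier [a] with [conj f = a * f] must equal [conj f / f] on the
    cozero-set of [f], and off that set the equation reads [0 = 0].  So
    conjugation is a local multiplication exactly when every unimodular function
    [conj f / f] extends continuously from the cozero-set of [f] to [X].

    On an F-space such extensions exist, because the real and imaginary parts of
    [conj f / f] are continuous and bounded on the cozero-set
    ([conj_local_multiplication_of_F_space]).

    For the converse, a bounded real function [f] on the cozero-set of [h] has
    to be encoded in an element of C(X).  With [k = |h|^2] the product [k f]
    tends to 0 at the boundary ([continuous_mul_bounded]), so [F = k (1 + i f)]
    lies in C(X).  The multiplier of [F] extends the Cayley transform
    [(1 - i f) / (1 + i f)] of [f], and inverting that transform recovers [f].
    As [f] is bounded, its Cayley transform stays away from -1, the pole of the
    inverse, and truncating the denominator yields a function that is continuous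
    on all of [X] ([F_space_of_conj_local_multiplication]).  Complete regularity
    comes from the normality of compact Hausdorff spaces.

    For the description of the real-linear local multiplications: if [T] is a
    local multiplication, [T g] vanishes wherever [g] does.  Applied at each
    point [x] to [g = f - Re (f x) - Im (f x) i], this gives the formula for
    real-linear [T] ([real_local_multiplicationE]).  A map given by the formula
    is real-linear; it is a local multiplication once conjugation is one,
    because [Re f] and [Im f] are combinations of [f] and [conj f]
    ([formula_local_multiplication]).  Since conjugation satisfies the
    formula, it is a local multiplication whenever all maps given by the formula
    are, which closes the cycle. *)

(** * Pointwise values and real parts of complex functions *)

Section evaluation.
Context {R : realType} {X : topologicalType}.
Implicit Types (f g : cfun R X) (a : R[i]) (x : X).

(** These evaluation rules are keyed on [cfun_apply], the coercion through which
    values are displayed, so that rewriting reaches nested expressions. *)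
Lemma cfun_addE f g x : cfun_apply (f + g) x = f x + g x. Proof. by []. Qed.
Lemma cfun_oppE f x : cfun_apply (- f) x = - f x. Proof. by []. Qed.
Lemma cfun_mulE f g x : cfun_apply (f * g) x = f x * g x. Proof. by []. Qed.
Lemma cfun_oneE x : cfun_apply (1 : cfun R X) x = 1. Proof. by []. Qed.
Lemma cfun_cstE a x : cfun_apply (cfun_cst a) x = a. Proof. by []. Qed.
Lemma cfun_scaleE a f x : cfun_apply (a *: f) x = a * f x. Proof. by []. Qed.

Lemma cfun_eqE f g : f = g -> forall x, cfun_apply f x = cfun_apply g x.
Proof. by move=> ->. Qed.

Definition cfunE := (cfun_addE, cfun_oppE, cfun_mulE, cfun_oneE, cfun_cstE,
  cfun_scaleE, @cfun_conjE R X, @cfun_ReE R X, @cfun_ImE R X).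

End evaluation.

Section complex_parts.
Context {R : realType} {X : topologicalType}.
Implicit Types (f : cfun R X) (u v : X -> R).

Lemma normc_real (r : R) : `|r%:C%C| = `|r|%:C%C.
Proof. by rewrite normc_def /= expr0n addr0 sqrtr_sqr. Qed.

Lemma continuous_lip_part (t : R[i] -> R) f :
  (forall z w, `|(t z)%:C%C - (t w)%:C%C| <= `|z - w|) ->
  continuous (fun x => t (f x)).
Proof.
move=> lip x; apply/cvgrPdist_lt => e e0.
have e0' : 0 < e%:C%C :> R[i] by rewrite ltcR.
have /(@cvgrPdist_lt _ R[i]^o) /(_ _ e0') := @cfun_continuous _ _ f x.
apply: filterS => y /(le_lt_trans (lip _ _)).
by rewrite -rmorphB normc_real ltcR.
Qed.

Lemma continuous_Re f : continuous (fun x => complex.Re (f x)).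
Proof. exact: continuous_lip_part Re_lip. Qed.

Lemma continuous_Im f : continuous (fun x => complex.Im (f x)).
Proof. exact: continuous_lip_part Im_lip. Qed.

Lemma continuous_real_complex u :
  continuous u -> continuous ((fun x => (u x)%:C%C) : X -> R[i]^o).
Proof.
move=> cu x; apply/(@cvgrPdist_lt _ R[i]^o) => -[e e'].
rewrite ltcE /= => /andP[/eqP -> e0].
have /cvgrPdist_lt /(_ _ e0) := cu x.
by apply: filterS => y; rewrite -rmorphB normc_real ltcR.
Qed.

Lemma cfun_of_parts u v : continuous u -> continuous v ->
  exists f, forall x, f x = (u x +i* v x)%C.
Proof.
move=> cu cv.
pose u' : cfun R X := cfun_of (continuous_real_complex u cu).
pose v' : cfun R X := cfun_of (continuous_real_complex v cv).
exists (u' + cfun_cst 'i%C * v') => x.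
by rewrite !cfunE /u' /v' /cfun_apply /=; simpc.
Qed.

(** The complex equation as a real linear system in the two parts of [z]:
    everything that involves division is then done over the reals. *)
Lemma conjc_eq_mulP (z w : R[i]) :
  conjc w = z * w <->
  complex.Re z * complex.Re w - complex.Im z * complex.Im w = complex.Re w /\
  complex.Re z * complex.Im w + complex.Im z * complex.Re w = - complex.Im w.
Proof.
case: z w => [p q] [c d] /=; split.
  by case=> e1 e2; split; [rewrite {2}e1|rewrite e2].
by case=> e1 e2; apply/eqP; rewrite eq_complex /= e1 e2 !eqxx.
Qed.

End complex_parts.

(** * Conjugation and the F-space property *)

Lemma open_cozero {R : realType} {X : topologicalType} (k : X -> R) :
  continuous k -> open [set x | k x != 0].
Proof.
move=> ck; have -> : [set x | k x != 0] = k @^-1` (~` [set 0]).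
  by apply/seteqP; split => x /= /eqP.
by apply: open_comp; [move=> x _; exact: ck | rewrite openC; exact: closed_eq].
Qed.

(** At a zero [x] of [k] the product tends to [0] because [f] is bounded where
    [k] does not vanish; near any other point [f] itself is continuous, the
    cozero-set being open. *)
Lemma continuous_mul_bounded {R : realType} {X : topologicalType}
    (k f : X -> R) :
  continuous k -> {within [set x | k x != 0], continuous f} ->
  [bounded f x | x in [set x | k x != 0]] ->
  continuous (fun x => k x * f x).
Proof.
move=> ck cf bf x; have [kx0|kx0] := eqVneq (k x) 0.
  have [M M0 fM] := pinfty_ex_gt0 bf.
  apply/cvgrPdist_lt => e e0; rewrite kx0 mul0r.
  (* With [|f| <= M], it is enough that [|k| < e / M]. *)
  have eM : 0 < e / M by rewrite divr_gt0.
  have /cvgrPdist_lt /(_ _ eM) := ck x.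
  apply: filterS => y; rewrite kx0 !sub0r !normrN normrM.
  rewrite ltr_pdivlMr// => /(le_lt_trans _); apply.
  have [->|ky0] := eqVneq (k y) 0; first by rewrite normr0 !mul0r.
  by rewrite ler_wpM2l//; exact: fM.
apply: cvgM; first exact: ck.
move: cf; rewrite continuous_open_subspace; last exact: open_cozero.
by apply; rewrite inE.
Qed.

(** With [a = Re f] and [b = Im f],
    [conj f / f = (conj f)^2 / |f|^2 = (a^2 - b^2 - 2 a b i) / (a^2 + b^2)],
    and both parts are bounded by 1.  Off the cozero-set both sides of
    [conj f = g f] vanish, so the values of the extension there are harmless. *)
Lemma conj_local_multiplication_of_F_space {R : realType}
    {X : topologicalType} :
  F_space R X -> local_multiplication (@cfun_conj R X).
Proof.
move=> [_ _ ext] f.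
pose a x := complex.Re (f x); pose b x := complex.Im (f x).
pose s x := a x ^+ 2 + b x ^+ 2.
have ca : continuous a by exact: continuous_Re.
have cb : continuous b by exact: continuous_Im.
pose A := [set x | f x != 0].
have cozA : cozero_set R A by exists f.
have sA x : A x -> 0 < s x.
  rewrite /A /s /a /b /= eq_complex /= negb_and => /orP[] n0.
    by rewrite ltr_pwDl ?sqr_ge0// exprn_even_gt0.
  by rewrite ltr_pwDr ?sqr_ge0// exprn_even_gt0.
have cs : continuous s.
  by move=> x; apply: cvgD; apply: cvgM; (exact: ca || exact: cb).
have extS (t : X -> R) : continuous t -> (forall x, `|t x| <= s x) ->
    exists2 g : X -> R, continuous g & forall x, A x -> g x = t x / s x.
  move=> ct ts.
  have [|| g [cg _ gE]] := ext A cozA (fun x => t x / s x); last by exists g.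
  - apply: continuous_in_subspaceT => x; rewrite inE => Ax.
    by apply: cvgM; [exact: ct|apply: cvgV; [rewrite gt_eqF// sA|exact: cs]].
  - exists 1; split=> [|M /ltW M1 x Ax /=]; first exact: num_real.
    apply: le_trans M1.
    by rewrite normrM normfV (gtr0_norm (sA _ Ax)) ler_pdivrMr ?mul1r ?sA.
have [||u cu uE] := extS (fun x => a x ^+ 2 - b x ^+ 2).
- move=> x; apply: cvgB; apply: cvgM; (exact: ca || exact: cb).
- move=> x; rewrite ler_norml /s.
  have := sqr_ge0 (a x); have := sqr_ge0 (b x).
  by move=> *; apply/andP; split; lra.
have [||v cv vE] := extS (fun x => - (2 * (a x * b x))).
- move=> x; apply: cvgN; apply: cvgM; first exact: cvg_cst.
  by apply: cvgM; (exact: ca || exact: cb).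
- move=> x; rewrite ler_norml /s.
  have := sqr_ge0 (a x - b x); have := sqr_ge0 (a x + b x).
  by rewrite sqrrB sqrrD => *; apply/andP; split; lra.
have [g gE] := cfun_of_parts u v cu cv.
exists g; apply: cfun_ext => x; rewrite !cfunE.
have [fx0|fx0] := eqVneq (f x) 0; first by rewrite fx0 conjc0 mulr0.
have sx := sA _ fx0.
apply/conjc_eq_mulP; rewrite gE /= uE// vE// -/(a x) -/(b x).
have s0 : a x ^+ 2 + b x ^+ 2 != 0 by rewrite gt_eqF.
by rewrite /s; split; field.
Qed.

(** If [p + i q] is the multiplier of [F = k (1 + i f)], then on the cozero-set
    [p = (1 - f^2) / (1 + f^2)] and [q = - 2 f / (1 + f^2)], whence
    [f = - q / (1 + p)].  There [1 + p = 2 / (1 + f^2)] is at least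
    [c = 2 / (1 + M^2)] when [|f| <= M], so replacing the denominator by
    [max c (1 + p)] changes nothing on the cozero-set and makes the quotient
    continuous everywhere.  Compactness bounds it. *)
Lemma F_space_of_conj_local_multiplication {R : realType}
    {X : topologicalType} :
  compact [set: X] -> hausdorff_space X ->
  local_multiplication (@cfun_conj R X) -> F_space R X.
Proof.
move=> cX hX lm; split=> //.
  apply: (@normal_completely_regular R); first exact: compact_normal.
  exact: hausdorff_accessible.
move=> A [h AE] f cf bf.
pose k x := complex.Re (h x) ^+ 2 + complex.Im (h x) ^+ 2.
have ck : continuous k.
  move=> x; apply: cvgD; apply: cvgM;
    (exact: continuous_Re || exact: continuous_Im).
have kE : A = [set x | k x != 0].
  rewrite AE; apply/seteqP; split => x /=;
  by rewrite eq_complex /= /k paddr_eq0 ?sqr_ge0// !sqrf_eq0.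
have ckf : continuous (fun x => k x * f x).
  by apply: continuous_mul_bounded; rewrite // -kE.
have [F FE] := cfun_of_parts k _ ck ckf.
have [a aF] := lm F.
have [M M0 fM] := pinfty_ex_gt0 bf.
pose p x := complex.Re (a x); pose q x := complex.Im (a x).
pose c := 2 / (1 + M ^+ 2).
have c0 : 0 < c by rewrite divr_gt0// ltr_pwDl// sqr_ge0.
pose g x := - q x / Num.max c (1 + p x).
have cg : continuous g.
  move=> x; apply: cvgM; first by apply: cvgN; exact: continuous_Im.
  apply: cvgV; first by rewrite gt_eqF// lt_max c0.
  apply: (@continuous_max _ _ (cst c) (fun x => 1 + p x)); first exact: cvg_cst.
  by apply: cvgD; [exact: cvg_cst|exact: continuous_Re].
exists g; split => //.
  have /compact_bounded [N [Nr bN]] : compact (range g).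
    apply: continuous_compact => //; exact: continuous_subspaceT.
  by exists N; split => // N' /bN bN' x _; apply: bN'; exists x.
move=> x Ax; have kx : k x != 0 by move: Ax; rewrite kE.
have := cfun_eqE _ _ aF x; rewrite !cfunE => /conjc_eq_mulP.
rewrite FE /= -/(p x) -/(q x) => -[e1 e2].
have {}e1 : p x - q x * f x = 1.
  by apply: (mulfI kx); rewrite mulr1 -{2}e1; ring.
have {}e2 : p x * f x + q x = - f x.
  by apply: (mulfI kx); rewrite mulrN -e2; ring.
have f1 : 0 < 1 + f x ^+ 2 by rewrite ltr_pwDl// sqr_ge0.
have pE : 1 + p x = 2 / (1 + f x ^+ 2).
  by apply: (mulIf (lt0r_neq0 f1)); rewrite divfK ?gt_eqF//; nra.
have qE : q x = - (2 * f x) / (1 + f x ^+ 2).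
  by apply: (mulIf (lt0r_neq0 f1)); rewrite divfK ?gt_eqF//; nra.
have -> : g x = - q x / (1 + p x).
  rewrite /g; congr (_ / _); apply/max_idPr; rewrite pE ler_pM2l//.
  rewrite lef_pV2 ?posrE ?lerD2l//; last by rewrite ltr_pwDl// sqr_ge0.
  by rewrite -real_normK ?num_real// lerXn2r ?nnegrE ?(ltW M0)//; exact: fM.
by rewrite qE pE; field; rewrite gt_eqF.
Qed.

(** * Real-linear local multiplications *)

(** The value of [T f] at [x] only sees [f x]: the function [g] of the proof,
    which is [f] minus a real combination of [1] and [i], vanishes at [x], and so
    does its multiple [T g]. *)
Lemma real_local_multiplicationE {R : realType} {X : topologicalType}
    (T : cfun R X -> cfun R X) :
  real_linear T -> local_multiplication T ->
  forall f, T f = T 1 * cfun_Re f + T (cfun_cst 'i%C) * cfun_Im f.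
Proof.
move=> lT mT f; apply: cfun_ext => x.
rewrite !cfunE.
set r := complex.Re (f x); set s := complex.Im (f x).
pose g : cfun R X := (- r)%:C%C *: (1 : cfun R X)
  + ((- s)%:C%C *: cfun_cst 'i%C + f).
have gx0 : cfun_apply g x = 0.
  rewrite /g !cfunE /r /s /=.
  by case: (f x) => c d /=; simpc; rewrite !addNr.
have [a Tg] := mT g.
have := cfun_eqE _ _ Tg x; rewrite cfun_mulE gx0 mulr0.
rewrite /g !lT !cfunE !rmorphN /=.
move=> /eqP; rewrite addrA addr_eq0 => /eqP H.
apply: oppr_inj; rewrite -H; ring.
Qed.

Lemma conj_formula {R : realType} {X : topologicalType} (f : cfun R X) :
  cfun_conj f = cfun_conj 1 * cfun_Re f + cfun_conj (cfun_cst 'i%C) * cfun_Im f.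
Proof.
apply: cfun_ext => x; rewrite !cfunE.
by case: (f x) => c d /=; simpc.
Qed.

Lemma formula_real_linear {R : realType} {X : topologicalType}
    (T : cfun R X -> cfun R X) :
  (forall f, T f = T 1 * cfun_Re f + T (cfun_cst 'i%C) * cfun_Im f) ->
  real_linear T.
Proof.
move=> TE r f g; rewrite TE (TE f) (TE g); apply: cfun_ext => x.
rewrite !cfunE.
have -> : complex.Re (r%:C%C * f x + g x)
    = r * complex.Re (f x) + complex.Re (g x).
  by case: (f x) (g x) => [c d] [c' d'] /=; rewrite mul0r subr0.
have -> : complex.Im (r%:C%C * f x + g x)
    = r * complex.Im (f x) + complex.Im (g x).
  by case: (f x) (g x) => [c d] [c' d'] /=; rewrite mul0r addr0.
rewrite !rmorphD !rmorphM /=; ring.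
Qed.

(** If [conj f = a f], then [Re f = (1 + a) f / 2] and
    [Im f = - i (1 - a) f / 2], which gives the multiplier of [T f]. *)
Lemma formula_local_multiplication {R : realType} {X : topologicalType}
    (T : cfun R X -> cfun R X) :
  local_multiplication (@cfun_conj R X) ->
  (forall f, T f = T 1 * cfun_Re f + T (cfun_cst 'i%C) * cfun_Im f) ->
  local_multiplication T.
Proof.
move=> lm TE f; have [a fE] := lm f.
exists (cfun_cst 2^-1 * (T 1 * (1 + a)
  + T (cfun_cst 'i%C) * (cfun_cst (- 'i%C) * (1 - a)))).
rewrite TE; apply: cfun_ext => x.
have := cfun_eqE _ _ fE x; rewrite !cfunE => fEx.
have two0 : (2 : R[i]) != 0 by rewrite pnatr_eq0.
have ReE : 2 * (complex.Re (f x))%:C%C = f x + conjc (f x).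
  case: (f x) => c d /=; apply/eqP; rewrite eq_complex /=.
  by apply/andP; split; apply/eqP; ring.
have ImE : 2 * (complex.Im (f x))%:C%C = - 'i%C * (f x - conjc (f x)).
  case: (f x) => c d /=; apply/eqP; rewrite eq_complex /=.
  by apply/andP; split; apply/eqP; ring.
apply: (mulfI two0); rewrite [LHS]mulrDr !(mulrCA 2 (T _ x)) ReE ImE fEx.
by rewrite -[in RHS]mulrA mulVKf//; ring.
Qed.

Theorem theorem6 (R : realType) (X : topologicalType)
    (X_compact : compact [set: X]) (X_hausdorff : hausdorff_space X) :
  [<-> local_multiplication (@cfun_conj R X);
       F_space R X;
       [set T : cfun R X -> cfun R X | real_linear T /\ local_multiplication T]
       = [set T : cfun R X -> cfun R X | forall f : cfun R X,
           T f = T 1 * cfun_Re f + T (cfun_cst 'i%C) * cfun_Im f]].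
Proof.
split; first exact: F_space_of_conj_local_multiplication.
split.
  move=> /conj_local_multiplication_of_F_space lm.
  apply/seteqP; split => [T [lT mT]|T TE].
    exact: real_local_multiplicationE.
  split; first exact: formula_real_linear.
  exact: formula_local_multiplication.
move=> E; have : [set T : cfun R X -> cfun R X | forall f : cfun R X,
    T f = T 1 * cfun_Re f + T (cfun_cst 'i%C) * cfun_Im f] (@cfun_conj R X).
  exact: conj_formula.
by rewrite -E => -[].
Qed.
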